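(* The calibration measure $\mathrm{ATB}$ has the following properties. (i) (Interim truthfulness) For every positive integer $T$ and all $\boldsymbol p,\boldsymbol r\in[0,1]^T$, $\mathbb E_{\boldsymbol y\sim\boldsymbol p}[\mathrm{ATB}(\boldsymbol p,\boldsymbol y)]\le\mathbb E_{\boldsymbol y\sim\boldsymbol p}[\mathrm{ATB}(\boldsymbol r,\boldsymbol y)]$. (ii) (Error decomposition) For every positive integer $T$ and all $\boldsymbol p=(p_1,\ldots,p_T),\boldsymbol r\in[0,1]^T$, $$\mathbb E_{\boldsymbol y\sim\boldsymbol p}[\mathrm{ATB}(\boldsymbol r,\boldsymbol y)]=\mathrm{ATB}(\boldsymbol r,\boldsymbol p)+\frac1{T^2}\sum_{t=1}^Tp_t(1-p_t).$$ (iii) (Strict ex-ante truthfulness) Let $X$ be a non-empty domain, $D$ a distribution of $(x,y)\in X\times\{0,1\}$, $p:X\to[0,1]$ the ground-truth predictor $p(x)=\mathbb E_D[y\mid x]$, $T$ a positive integer, and $S=((x_t,y_t))_{t=1}^T$ a sample of $T$ i.i.d. points from $D$. For every predictor $r:X\to[0,1]$, $\mathbb E_S[\mathrm{ATB}_{D_S}(p)]\le\mathbb E_S[\mathrm{ATB}_{D_S}(r)]$, and if equality holds then $r(x)=p(x)$ almost surely over $(x,y)\sim D$.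
   Context: Notation: $\boldsymbol y\sim\boldsymbol p$ means that $\boldsymbol y=(y_1,\ldots,y_T)\in\{0,1\}^T$ has independent coordinates, $y_t$ being Bernoulli with mean $p_t$. For $\boldsymbol r,\boldsymbol p\in[0,1]^T$ (the second argument may in particular lie in $\{0,1\}^T$), $$\mathrm{ATB}(\boldsymbol r,\boldsymbol p)=\mathbb E_{q\sim\mathrm{Unif}([0,1])}\left[\frac1{T^2}\left(\Big(\sum_{t:r_t<q}(r_t-p_t)\Big)^2+\Big(\sum_{t:r_t\ge q}(r_t-p_t)\Big)^2\right)\right].$$ For a predictor $r:X\to[0,1]$ and a sample $S=((x_t,y_t))_{t=1}^T$, $D_S$ denotes the uniform distribution over $S$ and $\mathrm{ATB}_{D_S}(r):=\mathrm{ATB}\big((r(x_1),\ldots,r(x_T)),(y_1,\ldots,y_T)\big)$. Predictors are assumed measurable. *)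

(* Defs.v *)
From HB Require Import structures.
From mathcomp Require Import all_boot all_order all_algebra.
From mathcomp Require Import all_classical all_reals all_analysis.

Set Implicit Arguments.
Unset Strict Implicit.
Unset Printing Implicit Defensive.

Import Order.TTheory GRing.Theory Num.Theory.
Import numFieldNormedType.Exports.

Local Open Scope classical_set_scope.
Local Open Scope ring_scope.

Definition unit_vector {R : realType} {T : nat} (r : 'I_T -> R) : Prop :=
  forall t, 0 <= r t <= 1.

(* A vector of outcomes in {0,1}^T, seen as a vector of reals. *)
Definition outcomes (R : realType) {T : nat} (y : 'I_T -> bool) : 'I_T -> R :=
  fun t => (y t)%:R.

(* The integrand takes finitely many values, each on an interval of q, and is
   bounded, so its expectation is finite and fine loses nothing. *)
Definition ATB {R : realType} {T : nat} (r p : 'I_T -> R) : R :=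
  fine ('E_(uniform_prob (@ltr01 R))[fun q : R =>
    (T%:R ^+ 2)^-1 * ((\sum_(t < T | r t < q) (r t - p t)) ^+ 2
                    + (\sum_(t < T | q <= r t) (r t - p t)) ^+ 2)]).

Section random_vectors.
Context {dO dV : measure_display} {Omega : measurableType dO}
  {V : measurableType dV} {R : realType}.

Definition mutually_independent (P : probability Omega R) {I : finType}
    (Z : I -> {RV P >-> V}) : Prop :=
  forall (J : {set I}) (A : I -> set V),
    (forall i, i \in J -> measurable (A i)) ->
    P (\bigcap_(i in [set` J]) (Z i @^-1` A i)) =
      (\prod_(i in J) P (Z i @^-1` A i))%E.

Definition has_law (P : probability Omega R) (Z : {RV P >-> V})
    (mu : set V -> \bar R) : Prop :=
  forall A, measurable A -> distribution P Z A = mu A.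

Definition iid_sample (D : probability V R) (P : probability Omega R)
    {T : nat} (S : 'I_T -> {RV P >-> V}) : Prop :=
  mutually_independent S /\ forall t, has_law (S t) D.

End random_vectors.

(* y ~ p, for y realized on a probability space (Omega, P). *)
Definition bernoulli_vector {dO : measure_display} {Omega : measurableType dO}
    {R : realType} {T : nat} (P : probability Omega R)
    (y : 'I_T -> {RV P >-> bool}) (p : 'I_T -> R) : Prop :=
  mutually_independent y /\ forall t, has_law (y t) (bernoulli_prob (p t)).

Section predictors.
Context {dX : measure_display} {X : measurableType dX} {R : realType}.

Definition predictor (r : X -> R) : Prop :=
  measurable_fun [set: X] r /\ forall x, 0 <= r x <= 1.

(* p is a version of the conditional expectation E_D[y | x]. *)
Definition ground_truth (D : probability (X * bool)%type R) (p : X -> R) :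
    Prop :=
  predictor p /\
  forall A : set X, measurable A ->
    (\int[D]_(z in fst @^-1` A) (p z.1)%:E =
     \int[D]_(z in fst @^-1` A) (z.2%:R)%:E)%E.

Definition ATB_sample {T : nat} (S : 'I_T -> X * bool) (r : X -> R) : R :=
  ATB (fun t => r (S t).1) (outcomes R (fun t => (S t).2)).

End predictors.

(* Main.v *)
(** For fixed [q], ATB is a sum of two squares of sums of residuals, one over
    the predictions below [q] and one over those at or above [q].  When the
    terms are independent, the expected square of such a sum is the square of
    the sum of the means plus the sum of the variances, and the second moments
    of the two residuals of a single prediction add up to its squared error,
    whatever [q].  With fixed predictions this gives the error decomposition,
    and interim truthfulness follows because ATB is nonnegative and vanishes
    when the predictions are the means.  For an i.i.d. sample the expected ATB
    is [1/T] times the squared error plus [1 - 1/T] times the mean over [q] of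
    the squared expected residuals.  The latter vanish for the ground truth, and
    by orthogonality the former exceeds that of the ground truth by
    [E (r - p)^2 / T]. *)

Require Import Defs.
From HB Require Import structures.
From mathcomp Require Import all_boot all_order all_algebra.
From mathcomp Require Import all_classical all_reals all_analysis.
From mathcomp Require Import measurable_realfun ring.

Set Implicit Arguments.
Unset Strict Implicit.
Unset Printing Implicit Defensive.

Import Order.TTheory GRing.Theory Num.Theory.
Import numFieldNormedType.Exports.

Local Open Scope classical_set_scope.
Local Open Scope ring_scope.

(** * Algebra of bounded measurable functions *)

Section bounded_measurable.
Context {d : measure_display} {T : measurableType d} {R : realType}.
Implicit Types f g : T -> R.

(** The bound is uniform and no measure is mentioned, so such a function is integrable against every
    probability, and the class is closed under arithmetic and measurable substitution. All
    integrability conditions below reduce to it. *)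
Definition bounded_measurable f :=
  measurable_fun [set: T] f /\ exists M, forall x, `|f x| <= M.

Lemma bounded_measurable_cst (c : R) : bounded_measurable (fun=> c).
Proof. by split; [exact: measurable_cst | exists `|c|]. Qed.

Lemma bounded_measurableD f g : bounded_measurable f -> bounded_measurable g ->
  bounded_measurable (fun x => f x + g x).
Proof.
move=> [mf [M fM]] [mg [N gN]]; split; first exact: measurable_funD.
by exists (M + N) => x; rewrite (le_trans (ler_normD _ _))// lerD.
Qed.

Lemma bounded_measurableM f g : bounded_measurable f -> bounded_measurable g ->
  bounded_measurable (fun x => f x * g x).
Proof.
move=> [mf [M fM]] [mg [N gN]]; split; first exact: measurable_funM.
by exists (M * N) => x; rewrite normrM ler_pM.
Qed.

Lemma bounded_measurableN f : bounded_measurable f ->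
  bounded_measurable (fun x => - f x).
Proof.
move=> bf; under eq_fun do rewrite -mulN1r.
exact/bounded_measurableM/bf/bounded_measurable_cst.
Qed.

Lemma bounded_measurableB f g : bounded_measurable f -> bounded_measurable g ->
  bounded_measurable (fun x => f x - g x).
Proof. by move=> bf bg; exact/bounded_measurableD/bounded_measurableN. Qed.

Lemma bounded_measurableX f n : bounded_measurable f ->
  bounded_measurable (fun x => f x ^+ n).
Proof.
move=> bf; elim: n => [|n ih]; first exact: bounded_measurable_cst.
by under eq_fun do rewrite exprS; exact: bounded_measurableM.
Qed.

Lemma bounded_measurable_sum (I : Type) (s : seq I) (h : I -> T -> R) :
  (forall i, bounded_measurable (h i)) ->
  bounded_measurable (fun x => \sum_(i <- s) h i x).
Proof.
move=> bh; elim: s => [|i s ih].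
  by under eq_fun do rewrite big_nil; exact: bounded_measurable_cst.
by under eq_fun do rewrite big_cons; exact: bounded_measurableD.
Qed.

Lemma bounded_measurable_bool (b : T -> bool) :
  measurable_fun [set: T] b -> bounded_measurable (fun x => (b x)%:R).
Proof.
move=> mb; split; last by exists 1 => x; case: (b x); rewrite !(normr0, normr1).
exact: (@measurableT_comp _ _ _ _ _ _ (fun c : bool => c%:R : R) _ b).
Qed.

Lemma bounded_measurable_unit f : measurable_fun [set: T] f ->
  (forall x, 0 <= f x <= 1) -> bounded_measurable f.
Proof.
move=> mf f01; split=> //; exists 1 => x.
by have /andP[f0 f1] := f01 x; rewrite ger0_norm.
Qed.

End bounded_measurable.

Lemma bounded_measurable_comp {d1 d2 : measure_display}
    {T1 : measurableType d1} {T2 : measurableType d2} {R : realType}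
    (f : T2 -> R) (phi : T1 -> T2) :
  bounded_measurable f -> measurable_fun [set: T1] phi ->
  bounded_measurable (fun x => f (phi x)).
Proof.
by move=> [mf [M fM]] mphi; split; [exact: measurableT_comp | exists M].
Qed.

(** * Real-valued means under a probability *)

Section mean_value.
Context {d : measure_display} {T : measurableType d} {R : realType}
  (P : probability T R).
Implicit Types f g : T -> R.

Lemma bounded_measurable_integrable f : bounded_measurable f ->
  P.-integrable [set: T] (EFin \o f).
Proof.
move=> [mf [M fM]]; apply: measurable_bounded_integrable => //.
  exact: fin_num_fun_lty.
exists M; split; first exact: num_real.
by move=> x Mx y _ /=; exact: le_trans (fM y) (ltW Mx).
Qed.

Lemma expectationE f : bounded_measurable f ->
  ('E_P[f] = (\int[P]_x f x)%:E)%E.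
Proof.
move=> bf; rewrite unlock /Rintegral fineK//.
by apply: integrable_fin_num => //; exact: bounded_measurable_integrable.
Qed.

Lemma mean_cst (c : R) : \int[P]_x c = c.
Proof. by rewrite Rintegral_cst//= [X in fine X](probability_setT P) mulr1. Qed.

Lemma meanD f g : bounded_measurable f -> bounded_measurable g ->
  \int[P]_x (f x + g x) = \int[P]_x f x + \int[P]_x g x.
Proof.
by move=> bf bg; apply: RintegralD => //; exact: bounded_measurable_integrable.
Qed.

Lemma meanB f g : bounded_measurable f -> bounded_measurable g ->
  \int[P]_x (f x - g x) = \int[P]_x f x - \int[P]_x g x.
Proof.
by move=> bf bg; apply: RintegralB => //; exact: bounded_measurable_integrable.
Qed.

Lemma meanZ (c : R) f : bounded_measurable f ->
  \int[P]_x (c * f x) = c * \int[P]_x f x.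
Proof.
by move=> bf; apply: RintegralZl => //; exact: bounded_measurable_integrable.
Qed.

Lemma mean_sum (I : Type) (s : seq I) (h : I -> T -> R) :
  (forall i, bounded_measurable (h i)) ->
  \int[P]_x (\sum_(i <- s) h i x) = \sum_(i <- s) \int[P]_x h i x.
Proof.
move=> bh; elim: s => [|i s ih].
  by under eq_Rintegral do rewrite big_nil; rewrite mean_cst big_nil.
under eq_Rintegral do rewrite big_cons.
by rewrite meanD ?ih ?big_cons//; exact: bounded_measurable_sum.
Qed.

Lemma le_mean f g : bounded_measurable f -> bounded_measurable g ->
  (forall x, f x <= g x) -> \int[P]_x f x <= \int[P]_x g x.
Proof.
by move=> bf bg fg; apply: le_Rintegral => //;
  exact: bounded_measurable_integrable.
Qed.

Lemma mean_bool (b : T -> bool) : measurable_fun [set: T] b ->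
  \int[P]_x (b x)%:R = fine (P [set x | b x]).
Proof.
move=> mb; rewrite /Rintegral; congr fine.
have mS : measurable [set x | b x].
  by rewrite -[X in measurable X]setTI; exact: (mb _ [set true]).
rewrite -[X in P X]setIT -integral_indic//; apply: eq_integral => x _.
rewrite indicE; congr (_%:R%:E); congr nat_of_bool.
by apply/idP/idP; [move=> bx; exact: mem_set | move/set_mem].
Qed.

End mean_value.

(** * Means depending on a parameter, and Fubini *)

Section mean_section.
Context {d1 d2 : measure_display} {T1 : measurableType d1}
  {T2 : measurableType d2} {R : realType} (P2 : probability T2 R).
Implicit Types F : T1 * T2 -> R.

Lemma bounded_measurable_xsection F x : bounded_measurable F ->
  bounded_measurable (fun y => F (x, y)).
Proof. by move=> bF; exact: (bounded_measurable_comp bF). Qed.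

Lemma bounded_measurable_ysection F y : bounded_measurable F ->
  bounded_measurable (fun x => F (x, y)).
Proof. by move=> bF; exact: (bounded_measurable_comp bF). Qed.

Lemma EFin_mean_xsection F x : bounded_measurable F ->
  (\int[P2]_y F (x, y))%:E = (\int[P2]_y (F (x, y))%:E)%E.
Proof.
move=> bF; rewrite fineK//; apply: integrable_fin_num => //.
exact/bounded_measurable_integrable/bounded_measurable_xsection.
Qed.

Lemma bounded_measurable_mean F : bounded_measurable F ->
  bounded_measurable (fun x => \int[P2]_y F (x, y)).
Proof.
move=> bF; have [mF [M FM]] := bF; split.
  (* Measurability of the partial integral comes from Tonelli, which wants a nonnegative integrand.
     Adding the bound [M] provides one, and since [P2] has mass one the shift changes each mean by
     exactly [M]. *)
  have bFM : bounded_measurable (fun z => F z + M).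
    exact/bounded_measurableD/bounded_measurable_cst.
  rewrite (_ : (fun x => _) = (fun x => \int[P2]_y (F (x, y) + M) - M)).
    apply: measurable_funB => //; apply/measurable_EFinP.
    rewrite (_ : _ \o _ = fubini_F P2 (fun z => (F z + M)%:E)).
      apply: measurable_fun_fubini_tonelli_F.
        by apply/measurable_EFinP; case: bFM.
      by move=> z; rewrite lee_fin -lerBlDr sub0r (lerNnormlW (FM z)).
    by apply/funext => x /=; rewrite (EFin_mean_xsection x bFM).
  apply/funext => x; rewrite meanD ?mean_cst ?addrK//.
    exact: bounded_measurable_xsection.
  exact: bounded_measurable_cst.
exists M => x; apply: (le_trans (le_normr_Rintegral _ _)) => //.
  exact/bounded_measurable_integrable/bounded_measurable_xsection.
rewrite -[leRHS](mean_cst P2); apply: le_mean => //.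
  have [mFx [N FN]] := bounded_measurable_xsection x bF; split.
    exact: measurableT_comp.
  by exists N => y; rewrite normr_id.
exact: bounded_measurable_cst.
Qed.

End mean_section.

Section mean_product.
Context {d1 d2 : measure_display} {T1 : measurableType d1}
  {T2 : measurableType d2} {R : realType}
  (P1 : probability T1 R) (P2 : probability T2 R) (F : T1 * T2 -> R).
Hypothesis bF : bounded_measurable F.

Lemma mean_iterated :
  \int[P1]_x \int[P2]_y F (x, y) = \int[(P1 \x P2)%E]_z F z.
Proof.
rewrite [RHS]/Rintegral.
rewrite -(integral12_prod_meas1 (bounded_measurable_integrable _ bF)).
by congr fine; apply: eq_integral => x _; rewrite EFin_mean_xsection.
Qed.

Lemma mean_exchange :
  \int[P1]_x \int[P2]_y F (x, y) = \int[P2]_y \int[P1]_x F (x, y).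
Proof.
rewrite mean_iterated /Rintegral.
rewrite -(integral21_prod_meas1 (bounded_measurable_integrable _ bF)).
congr fine; apply: eq_integral => y _; rewrite fineK//.
apply: integrable_fin_num => //.
exact/bounded_measurable_integrable/bounded_measurable_ysection.
Qed.

End mean_product.

(** * Laws, products and sums of independent variables *)

Section independence.
Context {dO dV : measure_display} {Omega : measurableType dO}
  {V : measurableType dV} {R : realType} (P : probability Omega R).

Lemma mean_distribution {d : measure_display} {W : measurableType d}
    (X : {RV P >-> W}) (f : W -> R) : bounded_measurable f ->
  \int[P]_w f (X w) = \int[distribution P X]_v f v.
Proof.
move=> bf; rewrite /Rintegral integral_distribution//.
  by apply/measurable_EFinP; case: bf.
by apply: bounded_measurable_integrable; exact: bounded_measurable_comp.
Qed.

Lemma mean_law (X : {RV P >-> V}) (D : probability V R) (f : V -> R) :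
  has_law X D -> bounded_measurable f ->
  \int[P]_w f (X w) = \int[D]_v f v.
Proof.
move=> XD bf; rewrite mean_distribution// /Rintegral; congr fine.
by apply: eq_measure_integral => A mA _; exact: XD.
Qed.

Variables (I : finType) (Z : I -> {RV P >-> V}).
Hypothesis indepZ : mutually_independent Z.

Lemma independent_pair (s t : I) (A B : set V) : s != t ->
  measurable A -> measurable B ->
  P (Z s @^-1` A `&` Z t @^-1` B) = (P (Z s @^-1` A) * P (Z t @^-1` B))%E.
Proof.
move=> st mA mB.
(* Only the values of the family at [s] and [t] matter; [s != t] makes them [A] and [B]. *)
have := @indepZ [set s; t]%SET (fun i => if i == s then A else B).
rewrite big_setU1 ?inE//= big_set1 eqxx eq_sym (negbTE st) => <-; last first.
  by move=> i _; case: ifP.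
congr (P _); apply/seteqP; split=> [w [As Bt] i /=|w h].
  by rewrite !inE => /orP[] /eqP ->; rewrite ?eqxx// eq_sym (negbTE st).
split; first by have := h s; rewrite /= !inE eqxx => /(_ erefl).
by have := h t; rewrite /= !inE eqxx orbT eq_sym (negbTE st) => /(_ erefl).
Qed.

(** The joint law of [(Z s, Z t)] agrees with the product of the marginal laws on rectangles, hence
    everywhere by uniqueness of the product measure; Fubini then factors the integral of
    [f z.1 * g z.2]. *)
Lemma mean_independentM (s t : I) (f g : V -> R) : s != t ->
  bounded_measurable f -> bounded_measurable g ->
  \int[P]_w (f (Z s w) * g (Z t w)) =
  (\int[P]_w f (Z s w)) * (\int[P]_w g (Z t w)).
Proof.
move=> st bf bg; pose Y0 w := (Z s w, Z t w).
have mY : measurable_fun [set: Omega] Y0 by exact: measurable_fun_pair.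
pose Y : {RV P >-> (V * V)%type} :=
  HB.pack Y0 (isMeasurableFun.Build _ _ _ _ Y0 mY).
pose F (z : V * V) := f z.1 * g z.2.
have bF : bounded_measurable F.
  by apply: bounded_measurableM; exact: bounded_measurable_comp.
rewrite [LHS](mean_distribution Y bF).
transitivity (\int[(distribution P (Z s) \x distribution P (Z t))%E]_z F z).
  rewrite /Rintegral; congr fine; apply/esym.
  apply: eq_measure_integral => C mC _; apply: product_measure_unique => //.
  by move=> A B mA mB; rewrite -independent_pair.
rewrite -mean_iterated// !mean_distribution//.
under eq_Rintegral do rewrite /F/= meanZ// mulrC.
by rewrite meanZ// mulrC.
Qed.

(* Bienayme: only the diagonal terms of the expanded square survive. *)
Lemma mean_sqr_sum_independent (g : I -> V -> R) :
  (forall i, bounded_measurable (g i)) ->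
  \int[P]_w (\sum_i g i (Z i w)) ^+ 2 =
  (\sum_i \int[P]_w g i (Z i w)) ^+ 2 +
  \sum_i (\int[P]_w (g i (Z i w) ^+ 2) - (\int[P]_w g i (Z i w)) ^+ 2).
Proof.
move=> bg; pose G i w := g i (Z i w).
have bG i : bounded_measurable (G i) by exact: bounded_measurable_comp.
transitivity (\sum_i \sum_j \int[P]_w (G i w * G j w)).
  have bGG i j : bounded_measurable (fun w => G i w * G j w).
    exact: bounded_measurableM.
  under [RHS]eq_bigr do rewrite -mean_sum//.
  rewrite -mean_sum => [|i]; last exact: bounded_measurable_sum.
  apply: eq_Rintegral => w _; rewrite expr2 mulr_suml.
  by apply: eq_bigr => i _; rewrite mulr_sumr.
rewrite expr2 mulr_suml -big_split/=; apply: eq_bigr => i _.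
rewrite mulr_sumr (bigD1 i)//= [in RHS](bigD1 i)//= -!expr2.
under eq_Rintegral do rewrite -expr2.
under eq_bigr => j ji do rewrite mean_independentM 1?eq_sym//.
by rewrite -/(G i); ring.
Qed.

End independence.

(** * Residuals at a uniform threshold *)

Section uniform_threshold.
Context {R : realType}.
Local Notation U := (uniform_prob (@ltr01 R)).

Lemma mean_uniform_le (a : R) : 0 <= a <= 1 -> \int[U]_q (q <= a)%R%:R = a.
Proof.
move=> /andP[a0 a1]; rewrite mean_bool; last exact: measurable_fun_ler.
rewrite /= /uniform_prob integral_uniform_pdf.
rewrite (_ : _ `&` _ = `[0, a]%classic); last first.
  apply/seteqP; split=> q /=; rewrite !in_itv/=.
    by move=> [-> /andP[->]].
  by move=> /andP[q0 qa]; rewrite qa q0 (le_trans qa a1).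
rewrite (eq_integral (fun=> 1%:E)); last first.
  move=> q; rewrite inE/= in_itv/= => /andP[q0 qa].
  by rewrite /uniform_pdf q0 (le_trans qa a1) subr0 invr1.
rewrite integral_cst//= mul1e lebesgue_measure_itv/= lte_fin.
(* The length formula for the interval branches on [0 < a]; at [a = 0] it returns 0, which is again
   [a]. *)
by case: ltgtP a0 => //= _; rewrite subr0.
Qed.

(** With the threshold condition as an indicator factor, the restricted sums in [ATB] become sums
    over all [t], each term depending on a single sample point, as independence requires. *)
Definition residual_below (q a b : R) := (a < q)%R%:R * (a - b).
Definition residual_above (q a b : R) := (q <= a)%R%:R * (a - b).

(** Exactly one of the two indicators is 1. This is what removes [q] from the second moments. *)
Lemma residual_sqrD q a b :
  residual_below q a b ^+ 2 + residual_above q a b ^+ 2 = (a - b) ^+ 2.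
Proof.
by rewrite /residual_below /residual_above ltNge; case: (q <= a) => /=; ring.
Qed.

Lemma ATB_mean {T : nat} (r p : 'I_T -> R) :
  ATB r p = \int[U]_q ((T%:R ^+ 2)^-1 *
    ((\sum_t residual_below q (r t) (p t)) ^+ 2 +
     (\sum_t residual_above q (r t) (p t)) ^+ 2)).
Proof.
rewrite /ATB unlock; apply: eq_Rintegral => q _.
congr (_ * (_ ^+ 2 + _ ^+ 2)); rewrite big_mkcond; apply: eq_bigr => t _.
  by rewrite /residual_below; case: ifP => _; rewrite ?mul1r ?mul0r.
by rewrite /residual_above; case: ifP => _; rewrite ?mul1r ?mul0r.
Qed.

Lemma ATB_ge0 {T : nat} (r p : 'I_T -> R) : 0 <= ATB r p.
Proof.
rewrite ATB_mean; apply: Rintegral_ge0 => q _.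
by rewrite mulr_ge0 ?invr_ge0 ?exprn_ge0// addr_ge0// sqr_ge0.
Qed.

Lemma ATB_diag {T : nat} (p : 'I_T -> R) : ATB p p = 0.
Proof.
rewrite ATB_mean -[RHS](mean_cst U); apply: eq_Rintegral => q _.
rewrite /residual_below /residual_above !big1 => [|t _|t _].
- by rewrite expr0n/= addr0 mulr0.
- by rewrite subrr mulr0.
- by rewrite subrr mulr0.
Qed.

Context {d : measure_display} {V : measurableType d}.

Implicit Types q a b : V -> R.

Lemma bounded_measurable_residual_below q a b : measurable_fun [set: V] q ->
  bounded_measurable a -> bounded_measurable b ->
  bounded_measurable (fun v => residual_below (q v) (a v) (b v)).
Proof.
move=> mq ba bb; apply: bounded_measurableM; last exact: bounded_measurableB.
by apply: bounded_measurable_bool; apply: measurable_fun_ltr => //; case: ba.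
Qed.

Lemma bounded_measurable_residual_above q a b : measurable_fun [set: V] q ->
  bounded_measurable a -> bounded_measurable b ->
  bounded_measurable (fun v => residual_above (q v) (a v) (b v)).
Proof.
move=> mq ba bb; apply: bounded_measurableM; last exact: bounded_measurableB.
by apply: bounded_measurable_bool; apply: measurable_fun_ler => //; case: ba.
Qed.

End uniform_threshold.

(** * Expected ATB for independent data *)

Section mean_ATB.
Context {dO dV : measure_display} {Omega : measurableType dO}
  {V : measurableType dV} {R : realType} (P : probability Omega R).
Variables (T : nat) (Z : 'I_T -> {RV P >-> V}).
Variables (f : 'I_T -> V -> R) (o : 'I_T -> V -> bool).
Hypotheses (indepZ : mutually_independent Z) (pf : forall t, predictor (f t)).
Hypothesis mo : forall t, measurable_fun [set: V] (o t).
Local Notation U := (uniform_prob (@ltr01 R)).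

(** Data and threshold form one argument so that joint measurability, needed to exchange the two
    means, can be stated. *)
Let below t (z : V * R) := residual_below z.2 (f t z.1) (o t z.1)%:R.
Let above t (z : V * R) := residual_above z.2 (f t z.1) (o t z.1)%:R.

(* Exchanging the expectations over the sample and over the threshold q leaves,
   for each q, the second moments of two sums of independent variables. *)
Lemma expectation_ATB :
  ('E_P[fun w => ATB (fun t => f t (Z t w))
                     (outcomes R (fun t => o t (Z t w)))] =
  (\int[U]_q ((T%:R ^+ 2)^-1 *
    ((\sum_t \int[P]_w below t (Z t w, q)) ^+ 2 +
     (\sum_t \int[P]_w above t (Z t w, q)) ^+ 2 +
     \sum_t (\int[P]_w (f t (Z t w) - (o t (Z t w))%:R) ^+ 2
             - (\int[P]_w below t (Z t w, q)) ^+ 2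
             - (\int[P]_w above t (Z t w, q)) ^+ 2))))%:E)%E.
Proof.
have bf t : bounded_measurable (fun z : V * R => f t z.1).
  by have [mft ft01] := pf t; apply: bounded_measurable_unit => //;
    exact: measurableT_comp.
have bo t : bounded_measurable (fun z : V * R => (o t z.1)%:R : R).
  by apply: bounded_measurable_bool; exact: measurableT_comp.
have bb t : bounded_measurable (below t).
  exact: bounded_measurable_residual_below.
have ba t : bounded_measurable (above t).
  exact: bounded_measurable_residual_above.
have mZ t : measurable_fun [set: Omega * R] (fun z => (Z t z.1, z.2)).
  by apply: measurable_fun_pair => //; exact: measurableT_comp.
pose F (z : Omega * R) := (T%:R ^+ 2)^-1 *
  ((\sum_t below t (Z t z.1, z.2)) ^+ 2 + (\sum_t above t (Z t z.1, z.2)) ^+ 2).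
have bF : bounded_measurable F.
  apply: bounded_measurableM; first exact: bounded_measurable_cst.
  apply: bounded_measurableD; apply: bounded_measurableX;
    apply: bounded_measurable_sum => t.
    exact: (bounded_measurable_comp (bb t) (mZ t)).
  exact: (bounded_measurable_comp (ba t) (mZ t)).
rewrite (_ : (fun w => _) = (fun w => \int[U]_q F (w, q))); last first.
  by apply/funext => w; rewrite ATB_mean.
rewrite expectationE; last exact: bounded_measurable_mean.
rewrite mean_exchange//; congr EFin; apply: eq_Rintegral => q _.
have bbq t := bounded_measurable_ysection q (bb t).
have baq t := bounded_measurable_ysection q (ba t).
have bZ (g : V -> R) t : bounded_measurable g ->
    bounded_measurable (fun w => g (Z t w)).
  by move=> bg; exact: bounded_measurable_comp.
have bbZ t := bZ _ t (bbq t).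
have baZ t := bZ _ t (baq t).
rewrite /F/= meanZ; last first.
  by apply: bounded_measurableD; apply: bounded_measurableX;
    exact: bounded_measurable_sum.
congr (_ * _); rewrite meanD; last 2 first.
  by apply: bounded_measurableX; exact: bounded_measurable_sum.
  by apply: bounded_measurableX; exact: bounded_measurable_sum.
rewrite (mean_sqr_sum_independent indepZ bbq).
rewrite (mean_sqr_sum_independent indepZ baq).
(* Bienayme gives one variance sum below the threshold and one above. They are paired term by term,
   so that the two second moments of each [t] merge into its squared error. *)
rewrite addrACA -big_split/=; congr (_ + _); apply: eq_bigr => t _.
rewrite addrACA -meanD; last 2 first.
  exact: bounded_measurableX.
  exact: bounded_measurableX.
rewrite -opprD -addrA -opprD; congr (_ - _).
by apply: eq_Rintegral => w _; rewrite /below/above/= residual_sqrD.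
Qed.

End mean_ATB.

(** * Fixed predictions against Bernoulli outcomes *)

Lemma expectation_ATB_bernoulli {R : realType} {T : nat} (p r : 'I_T -> R)
    {dO : measure_display} {Omega : measurableType dO} (P : probability Omega R)
    (y : 'I_T -> {RV P >-> bool}) :
  unit_vector p -> unit_vector r -> bernoulli_vector y p ->
  ('E_P[fun w => ATB r (outcomes R (fun t => y t w))] =
   (ATB r p + (T%:R ^+ 2)^-1 * \sum_(t < T) p t * (1 - p t))%:E)%E.
Proof.
move=> p01 r01 [indep law].
have by_ t : bounded_measurable (fun w => (y t w)%:R : R).
  exact: bounded_measurable_bool.
have mean_y t : \int[P]_w (y t w)%:R = p t.
  rewrite mean_bool//.
  have := law t [set true] I; rewrite /distribution/= /pushforward/= => Py.
  rewrite [X in fine X](_ : _ = bernoulli_prob (p t) [set true]).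
    rewrite bernoulli_probE// !diracE mem_set// memNset//=.
    by rewrite mulr1 mulr0 addr0.
  by rewrite -Py; congr (P _).
have pr t : predictor (fun _ : bool => r t) by split.
(* Here the sample points are the outcomes themselves, and the [t]-th prediction is the constant
   [r t]. *)
rewrite (@expectation_ATB _ _ _ _ _ _ _ y (fun t _ => r t) (fun _ => id))//.
have mean_affine t (c : R) :
    \int[P]_w (c * (r t - (y t w)%:R)) = c * (r t - p t).
  rewrite meanZ ?meanB ?mean_cst ?mean_y//; first exact: bounded_measurable_cst.
  by apply: bounded_measurableB => //; exact: bounded_measurable_cst.
have mean_sqr t : \int[P]_w ((r t - (y t w)%:R) ^+ 2) =
    (r t - p t) ^+ 2 + p t * (1 - p t).
  (* A bit equals its own square, so the squared error is affine in [y t] and its mean depends on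
     [p t] alone. *)
  transitivity (\int[P]_w (r t ^+ 2 + (1 - 2 * r t) * (y t w)%:R)).
    by apply: eq_Rintegral => w _; case: (y t w) => /=; ring.
  rewrite meanD; [|exact: bounded_measurable_cst|]; last first.
    by apply: bounded_measurableM => //; exact: bounded_measurable_cst.
  by rewrite mean_cst meanZ// mean_y; ring.
congr EFin; rewrite ATB_mean.
set C := _ * \sum_(_ < _) _.
rewrite -[C in RHS](mean_cst (uniform_prob (@ltr01 R))) -meanD.
- apply: eq_Rintegral => q _; rewrite -mulrDr; congr (_ * _).
  rewrite /residual_below /residual_above/=.
  congr (_ ^+ 2 + _ ^+ 2 + _).
  + by apply: eq_bigr => t _; rewrite mean_affine.
  + by apply: eq_bigr => t _; rewrite mean_affine.
  (* The squares of the two mean residuals add up to [(r t - p t) ^+ 2], which cancels and leaves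
     the variance [p t * (1 - p t)] for every [q]. *)
  + apply: eq_bigr => t _; rewrite !mean_affine mean_sqr.
    rewrite -[in LHS](residual_sqrD q) /residual_below /residual_above.
    by ring.
- apply: bounded_measurableM; first exact: bounded_measurable_cst.
  apply: bounded_measurableD; apply: bounded_measurableX;
    apply: bounded_measurable_sum => t.
    by apply: bounded_measurable_residual_below => //;
      exact: bounded_measurable_cst.
  by apply: bounded_measurable_residual_above => //;
    exact: bounded_measurable_cst.
- exact: bounded_measurable_cst.
Qed.

(** * Orthogonality of the ground truth's error *)

Section ground_truth.
Context {dX : measure_display} {X : measurableType dX} {R : realType}.
Variables (D : probability (X * bool)%type R) (p : X -> R).
Hypothesis truth : ground_truth D p.
Local Notation U := (uniform_prob (@ltr01 R)).

Lemma bounded_measurable_predictor (g : X -> R) : predictor g ->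
  bounded_measurable (fun z : X * bool => g z.1).
Proof.
by move=> [mg g01]; apply: bounded_measurable_unit => //;
  exact: measurableT_comp.
Qed.

Lemma bounded_measurable_outcome :
  bounded_measurable (fun z : X * bool => z.2%:R : R).
Proof. exact: bounded_measurable_bool. Qed.

Lemma bounded_measurable_error (g : X -> R) : predictor g ->
  bounded_measurable (fun z : X * bool => g z.1 - z.2%:R).
Proof.
move=> pg; apply: bounded_measurableB.
  exact: bounded_measurable_predictor.
exact: bounded_measurable_outcome.
Qed.

Lemma mean_truth_event (b : X -> bool) : measurable_fun [set: X] b ->
  \int[D]_z ((b z.1)%:R * (p z.1 - z.2%:R)) = 0.
Proof.
move=> mb; have [pp eqp] := truth.
have mB : measurable [set x | b x].
  by rewrite -[X in measurable X]setTI; exact: (mb _ [set true]).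
have mB' : measurable (fst @^-1` [set x | b x] : set (X * bool)).
  by rewrite -[X in measurable X]setTI; exact: measurable_fst.
(* An indicator depending on [x] alone restricts the integral to a cylinder, where the defining
   equation of conditional expectation applies. *)
transitivity (\int[D]_(z in fst @^-1` [set x | b x]) (p z.1 - z.2%:R)).
  rewrite [RHS]Rintegral_mkcond; apply: eq_Rintegral => z _; rewrite patchE.
  case: ifPn; first by rewrite inE/= => ->; rewrite mul1r.
  by rewrite notin_setE/= => /negP/negbTE ->; rewrite mul0r.
rewrite RintegralB//; last 2 first.
- apply: (@integrableS _ _ _ _ [set: X * bool]) => //.
  exact/bounded_measurable_integrable/bounded_measurable_predictor.
- apply: (@integrableS _ _ _ _ [set: X * bool]) => //.
  exact/bounded_measurable_integrable/bounded_measurable_outcome.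
by rewrite /Rintegral eqp// subrr.
Qed.

(* Layer cake: [g x] is the mean of the indicators of [q <= g x] over q. *)
Lemma mean_truth_orthogonal (g : X -> R) : predictor g ->
  \int[D]_z (g z.1 * (p z.1 - z.2%:R)) = 0.
Proof.
move=> pg; have [mg g01] := pg; have [pp _] := truth.
pose F (u : X * bool * R) := (u.2 <= g u.1.1)%R%:R * (p u.1.1 - u.1.2%:R).
have bF : bounded_measurable F.
  apply: bounded_measurableM.
    apply: bounded_measurable_bool; apply: measurable_fun_ler => //.
    by apply: measurableT_comp => //; exact: measurableT_comp.
  exact: (bounded_measurable_comp (bounded_measurable_error pp)).
transitivity (\int[D]_z \int[U]_q F (z, q)).
  apply: eq_Rintegral => z _; rewrite -[in LHS](mean_uniform_le (g01 z.1)).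
  rewrite mulrC -meanZ; last first.
    by apply: bounded_measurable_bool; exact: measurable_fun_ler.
  by apply: eq_Rintegral => q _; rewrite mulrC.
rewrite mean_exchange// -[RHS](mean_cst U); apply: eq_Rintegral => q _.
by apply: (mean_truth_event (b := fun x => q <= g x));
  exact: measurable_fun_ler.
Qed.

(** Pythagoras: in the square of [(r - p) + (p - y)] the cross term has mean zero, because both [r]
    and [p] are functions of [x] and so orthogonal to [p - y]. *)
Lemma mean_sqr_error (r : X -> R) : predictor r ->
  \int[D]_z (r z.1 - z.2%:R) ^+ 2 =
  \int[D]_z (p z.1 - z.2%:R) ^+ 2 + \int[D]_z (r z.1 - p z.1) ^+ 2.
Proof.
move=> pr; have [pp _] := truth.
have bp := bounded_measurable_predictor pp.
have br := bounded_measurable_predictor pr.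
have be := bounded_measurable_error pp.
have bg g : predictor g ->
    bounded_measurable (fun z : X * bool => g z.1 * (p z.1 - z.2%:R)).
  by move=> pg; apply: bounded_measurableM be;
    exact: bounded_measurable_predictor.
transitivity (\int[D]_z ((p z.1 - z.2%:R) ^+ 2 + (r z.1 - p z.1) ^+ 2 +
    2 * (r z.1 * (p z.1 - z.2%:R) - p z.1 * (p z.1 - z.2%:R)))).
  by apply: eq_Rintegral => z _; ring.
have bep := bounded_measurableX 2 be.
have brp := bounded_measurableX 2 (bounded_measurableB br bp).
have brg := bg _ pr; have bpg := bg _ pp.
rewrite meanD; [|exact: bounded_measurableD|]; last first.
  apply: bounded_measurableM; first exact: bounded_measurable_cst.
  exact: bounded_measurableB.
rewrite meanD// meanZ; last exact: bounded_measurableB.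
by rewrite meanB// !mean_truth_orthogonal// subrr mulr0 addr0.
Qed.

(** A nonnegative function with zero integral vanishes almost everywhere, and a square vanishes only
    where its base does. *)
Lemma mean_sqr_eq0 (r : X -> R) : predictor r ->
  \int[D]_z (r z.1 - p z.1) ^+ 2 = 0 -> {ae D, forall z, r z.1 = p z.1}.
Proof.
move=> pr; have [pp _] := truth => e0.
have bd : bounded_measurable (fun z : X * bool => (r z.1 - p z.1) ^+ 2).
  apply/bounded_measurableX/bounded_measurableB;
    exact: bounded_measurable_predictor.
have [md _] := bd.
have := (ae_eq_integral_abs D measurableT
  (proj2 (measurable_EFinP _ _) md)).1.
case=> [|N [mN N0 sub]].
  have := congr1 EFin e0; rewrite -expectationE// unlock; apply: etrans.
  by apply: eq_integral => z _; rewrite /= ger0_norm// sqr_ge0.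
exists N; split=> // z /= rp; apply: sub => /= /(_ I) [] /eqP.
by rewrite sqrf_eq0 subr_eq0 => /eqP.
Qed.

End ground_truth.

(** * Expected ATB of an i.i.d. sample *)

Section ex_ante.
Context {dX dO : measure_display} {X : measurableType dX}
  {Omega : measurableType dO} {R : realType}.
Variables (D : probability (X * bool)%type R) (p : X -> R) (T : nat).
Variables (P : probability Omega R) (S : 'I_T -> {RV P >-> (X * bool)%type}).
Hypotheses (truth : ground_truth D p) (T0 : (0 < T)%N) (iidS : iid_sample D S).
Local Notation U := (uniform_prob (@ltr01 R)).

(** The expected residual of a single draw from [D]; by identical distribution all [T] sample points
    share it. *)
Let below (r : X -> R) q := \int[D]_z residual_below q (r z.1) z.2%:R.
Let above (r : X -> R) q := \int[D]_z residual_above q (r z.1) z.2%:R.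

Let bounded_measurable_below r : predictor r -> bounded_measurable (below r).
Proof.
move=> pr.
have bF : bounded_measurable (fun u : R * (X * bool) =>
    residual_below u.1 (r u.2.1) u.2.2%:R).
  apply: bounded_measurable_residual_below => //.
    exact: (bounded_measurable_comp (bounded_measurable_predictor pr)).
  exact: (bounded_measurable_comp bounded_measurable_outcome).
exact: (bounded_measurable_mean D bF).
Qed.

Let bounded_measurable_above r : predictor r -> bounded_measurable (above r).
Proof.
move=> pr.
have bF : bounded_measurable (fun u : R * (X * bool) =>
    residual_above u.1 (r u.2.1) u.2.2%:R).
  apply: bounded_measurable_residual_above => //.
    exact: (bounded_measurable_comp (bounded_measurable_predictor pr)).
  exact: (bounded_measurable_comp bounded_measurable_outcome).
exact: (bounded_measurable_mean D bF).
Qed.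

Lemma expectation_ATB_sample r : predictor r ->
  ('E_P[fun w => ATB_sample (fun t => S t w) r] =
   (T%:R^-1 * \int[D]_z (r z.1 - z.2%:R) ^+ 2 +
    (1 - T%:R^-1) * \int[U]_q (below r q ^+ 2 + above r q ^+ 2))%:E)%E.
Proof.
move=> pr; have [indep law] := iidS.
have pr1 : predictor (fun z : X * bool => r z.1).
  by have [mr r01] := pr; split=> //; exact: measurableT_comp.
rewrite (@expectation_ATB _ _ _ _ _ _ _ S (fun _ z => r z.1)
  (fun _ z => z.2))//; last by move=> t; exact: measurable_snd.
congr EFin.
have br := bounded_measurable_predictor pr.
have bo := @bounded_measurable_outcome _ X R.
have T0' : T%:R != 0 :> R by rewrite pnatr_eq0 -lt0n.
have bbq q : bounded_measurable (fun z : X * bool =>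
    residual_below q (r z.1) z.2%:R).
  exact: bounded_measurable_residual_below.
have baq q : bounded_measurable (fun z : X * bool =>
    residual_above q (r z.1) z.2%:R).
  exact: bounded_measurable_residual_above.
have bab : bounded_measurable (fun q => below r q ^+ 2 + above r q ^+ 2).
  apply: bounded_measurableD; apply: bounded_measurableX.
    exact: bounded_measurable_below.
  exact: bounded_measurable_above.
(* The right-hand side is written as one mean over [q], which reduces the claim to an identity at
   each threshold. *)
rewrite -(meanZ U _ bab) -[X in _ = X + _](mean_cst U) -meanD; last 2 first.
- exact: bounded_measurable_cst.
- by apply: bounded_measurableM => //; exact: bounded_measurable_cst.
apply: eq_Rintegral => q _ /=.
pose c := \int[D]_z (r z.1 - z.2%:R) ^+ 2.
have Pc t : \int[P]_w (r (S t w).1 - (S t w).2%:R) ^+ 2 = c :=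
  mean_law (law t) (bounded_measurableX 2 (bounded_measurable_error pr)).
have Pb t : \int[P]_w residual_below q (r (S t w).1) (S t w).2%:R = below r q :=
  mean_law (law t) (bbq q).
have Pa t : \int[P]_w residual_above q (r (S t w).1) (S t w).2%:R = above r q :=
  mean_law (law t) (baq q).
under eq_bigr do rewrite Pb.
under [X in _ + X ^+ 2 + _]eq_bigr do rewrite Pa.
under [X in _ + X]eq_bigr do rewrite Pb Pa Pc.
(* What remains is scalar algebra: [(T a)^2 + (T b)^2 + T (c - a^2 - b^2)] divided by [T^2] is
   [c / T + (1 - 1 / T) (a^2 + b^2)]. *)
rewrite -/c; move: (below r q) (above r q) c {Pa Pb Pc} => a b c.
rewrite !sumr_const card_ord -[in LHS](mulr_natl a) -[in LHS](mulr_natl b).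
by rewrite -[in LHS](mulr_natl (_ - _)); field.
Qed.

(** For fixed [q] the event [p x < q] depends on [x] only, and the ground truth is unbiased on every
    such event. *)
Lemma below_truth q : below p q = 0.
Proof.
by apply: (mean_truth_event truth (b := fun x => p x < q));
  apply: measurable_fun_ltr => //; have [[]] := truth.
Qed.

Lemma above_truth q : above p q = 0.
Proof.
by apply: (mean_truth_event truth (b := fun x => q <= p x));
  apply: measurable_fun_ler => //; have [[]] := truth.
Qed.

Lemma expectation_ATB_sample_truth :
  ('E_P[fun w => ATB_sample (fun t => S t w) p] =
   (T%:R^-1 * \int[D]_z (p z.1 - z.2%:R) ^+ 2)%:E)%E.
Proof.
rewrite expectation_ATB_sample; last by case: truth.
under [X in _ + _ * X]eq_Rintegral do
  rewrite below_truth above_truth expr0n/= addr0.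
by rewrite mean_cst mulr0 addr0.
Qed.

(** A quantitative gap, serving both optimality and the equality case. It discards only the mean
    squared expected residuals of [r], whose weight [1 - 1 / T] is nonnegative as [T] is at least
    1. *)
Lemma expectation_ATB_sample_ge r : predictor r ->
  ('E_P[fun w => ATB_sample (fun t => S t w) p] +
   (T%:R^-1 * \int[D]_z (r z.1 - p z.1) ^+ 2)%:E <=
   'E_P[fun w => ATB_sample (fun t => S t w) r])%E.
Proof.
move=> pr; rewrite expectation_ATB_sample_truth expectation_ATB_sample//.
rewrite -EFinD lee_fin -mulrDr -(mean_sqr_error truth pr) lerDl.
rewrite mulr_ge0//; last first.
  by apply: Rintegral_ge0 => q _; rewrite addr_ge0// sqr_ge0.
by rewrite subr_ge0 invf_le1 ?ler1n// ltr0n.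
Qed.

End ex_ante.

Theorem theorem4p8 (R : realType) :
  [/\ (* interim truthfulness *)
      forall (T : nat) (p r : 'I_T -> R),
        (0 < T)%N -> unit_vector p -> unit_vector r ->
      forall (dO : measure_display) (Omega : measurableType dO)
             (P : probability Omega R) (y : 'I_T -> {RV P >-> bool}),
        bernoulli_vector y p ->
        ('E_P[fun w => ATB p (outcomes R (fun t => y t w))] <=
         'E_P[fun w => ATB r (outcomes R (fun t => y t w))])%E,
      (* error decomposition *)
      forall (T : nat) (p r : 'I_T -> R),
        (0 < T)%N -> unit_vector p -> unit_vector r ->
      forall (dO : measure_display) (Omega : measurableType dO)
             (P : probability Omega R) (y : 'I_T -> {RV P >-> bool}),
        bernoulli_vector y p ->
        ('E_P[fun w => ATB r (outcomes R (fun t => y t w))] =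
         (ATB r p + (T%:R ^+ 2)^-1 * \sum_(t < T) p t * (1 - p t))%:E)%E
    & (* strict ex-ante truthfulness *)
      forall (dX : measure_display) (X : measurableType dX)
             (D : probability (X * bool)%type R) (p : X -> R) (T : nat),
        ground_truth D p -> (0 < T)%N ->
      forall (dO : measure_display) (Omega : measurableType dO)
             (P : probability Omega R)
             (S : 'I_T -> {RV P >-> (X * bool)%type}),
        iid_sample D S ->
      forall r : X -> R, predictor r ->
        ('E_P[fun w => ATB_sample (fun t => S t w) p] <=
         'E_P[fun w => ATB_sample (fun t => S t w) r])%E /\
        (('E_P[fun w => ATB_sample (fun t => S t w) p] =
          'E_P[fun w => ATB_sample (fun t => S t w) r])%E ->
         {ae D, forall z, r z.1 = p z.1})].
Proof.
split.
- move=> T p r T0 p01 r01 dO Omega P y yp.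
  (* The variance term is the same for both predictions, so [ATB p p = 0] is compared with
     [ATB r p]. *)
  rewrite !(@expectation_ATB_bernoulli _ _ p)//.
  by rewrite lee_fin lerD2r ATB_diag ATB_ge0.
- by move=> T p r T0 p01 r01 dO Omega P y yp; exact: expectation_ATB_bernoulli.
move=> dX X D p T truth T0 dO Omega P S iidS r pr.
have := expectation_ATB_sample_ge truth T0 iidS pr.
have T'0 : 0 < T%:R^-1 :> R by rewrite invr_gt0 ltr0n.
have := expectation_ATB_sample_truth truth T0 iidS.
set e := \int[D]_z (r z.1 - p z.1) ^+ 2.
have e0 : 0 <= e by apply: Rintegral_ge0 => z _; exact: sqr_ge0.
move=> -> ge; split.
  by apply: le_trans ge; rewrite leeDl// lee_fin mulr_ge0// ltW.
move=> eqr; apply: (mean_sqr_eq0 truth pr); rewrite -/e.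
(* The common expectation is a finite real and cancels from the gap inequality, which forces
   [e <= 0]. *)
move: ge; rewrite -eqr -EFinD lee_fin gerDl pmulr_rle0// => e0'.
by apply/eqP; rewrite eq_le e0' e0.
Qed.
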